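(* Let $G$ be an abelian group. There exists a symmetric subset $S$ of $G$ such that the Cayley graph $\mathrm{Cay}(G,S)$ has chromatic number exactly $3$ if and only if $\exp(G)\notin\{1,2,4\}$.
   Context: A subset $S$ of a group $G$ is symmetric if $x\in S$ if and only if $x^{-1}\in S$. The Cayley graph $\mathrm{Cay}(G,S)$ is the graph with vertex set $G$ in which $x$ and $y$ are adjacent if and only if $x^{-1}y\in S$. The exponent $\exp(G)$ is the least positive integer $k$ such that $g^k$ is the identity for all $g\in G$, and $\exp(G)=0$ if no such $k$ exists. *)

(* Defs.v *)
From HB Require Import structures.
From mathcomp Require Import all_boot.
From mathcomp Require Import boolp classical_sets.

Set Implicit Arguments.
Unset Strict Implicit.
Unset Printing Implicit Defensive.

Local Open Scope group_scope.

(* Graphs are given by their adjacency relation on a possibly infinite vertex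
   type; a vertex adjacent to itself (a loop) rules out every proper
   colouring. *)
Definition proper_coloring (V : Type) (adj : V -> V -> Prop) (k : nat)
    (c : V -> 'I_k) : Prop :=
  forall x y : V, adj x y -> c x <> c y.

Definition colorable (V : Type) (adj : V -> V -> Prop) (k : nat) : Prop :=
  exists c : V -> 'I_k, proper_coloring adj c.

Definition has_chromatic_number (V : Type) (adj : V -> V -> Prop) (k : nat)
    : Prop :=
  colorable adj k /\ forall m : nat, colorable adj m -> k <= m.

Definition symmetric_subset (G : groupType) (S : set G) : Prop :=
  forall x : G, S x <-> S x^-1.

Definition Cay (G : groupType) (S : set G) (x y : G) : Prop :=
  S (x^-1 * y).

Definition annihilates (G : groupType) (k : nat) : Prop :=
  0 < k /\ forall g : G, g ^+ k = 1.

Definition group_exponent (G : groupType) : nat :=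
  match pselect (exists k : nat, `[< annihilates G k >]) with
  | left exk => ex_minn exk
  | right _ => 0
  end.

Lemma group_exponentP (G : groupType) (k : nat) :
  annihilates G k ->
  annihilates G (group_exponent G) /\ group_exponent G <= k.
Proof.
move=> Hk; rewrite /group_exponent; case: pselect => [exk|nex].
  by case: ex_minnP => m /asboolP Hm minm; split=> //; apply/minm/asboolP.
by case: nex; exists k; apply/asboolP.
Qed.

Lemma group_exponent0 (G : groupType) :
  group_exponent G = 0 <-> ~ exists k : nat, annihilates G k.
Proof.
split=> [e0 [k Hk]|nex].
  by case: (group_exponentP Hk); rewrite e0 => -[].
rewrite /group_exponent; case: pselect => // exk.
by case: nex; case: exk => k /asboolP Hk; exists k.
Qed.

(* Main.v *)
Require Import Defs.
From HB Require Import structures.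
From mathcomp Require Import all_boot.
From mathcomp Require Import boolp classical_sets.
From mathcomp Require Import zify.

(** Suppose g ^ 4 = 1 on G and c is a proper 3-colouring of Cay(G, S). The
    number of ascents (steps that raise the colour by 1 modulo 3) along a walk
    in Cay(G, S) depends only on the multiset of its steps, because around a
    4-cycle a 3-colouring has winding number 0; likewise four equal steps,
    which form a closed walk, contain exactly 2 ascents. Hence if w is a closed
    walk with n steps, walking it 4 times gives 4 ups(w) = 2 n ascents, so n is
    even: Cay(G, S) has no odd closed walk and is 2-colourable.

    If some g has g ^ 4 <> 1, then a power h of g has infinite order, odd order
    at least 3, or order 8. The circulant graphs on <h> with connection sets
    {h^1, h^2}, {h^1} and {h^1, h^4} (and inverses) are then non-bipartite and
    3-colourable, and a colouring of <h> is copied to all cosets. *)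

Set Implicit Arguments.
Unset Strict Implicit.
Unset Printing Implicit Defensive.

Local Open Scope group_scope.

(** Serves both for connected components of the Cayley graph and for cosets of a cyclic subgroup:
    equivalent points have equal classes, hence the same chosen element. *)
Lemma class_representatives (T : choiceType) (x0 : T) (e : T -> T -> Prop) :
  (forall x, e x x) -> (forall x y, e x y -> e y x) ->
  (forall x y z, e x y -> e y z -> e x z) ->
  exists r : T -> T, (forall x, e x (r x)) /\ forall x y, e x y -> r x = r y.
Proof.
move=> er es et; exists (fun x => xget x0 [set y | e x y]%classic); split=> [x|x y exy].
  by case: xgetP => [y _ //|/(_ x)]; case; apply: er.
congr xget; apply/seteqP; split=> z /= ez; last exact: et ez.
by apply: et ez; apply: es.
Qed.

Lemma colorable_leq (V : Type) (adj : V -> V -> Prop) (m n : nat) :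
  m <= n -> colorable adj m -> colorable adj n.
Proof.
move=> le_mn [c cP]; exists (fun x => widen_ord le_mn (c x)) => x y /cP ncxy.
by move/(congr1 val)=> /= /val_inj.
Qed.

Lemma colorable_nat (V : Type) (adj : V -> V -> Prop) (k : nat) (c : V -> nat) :
  (forall x, c x < k) -> (forall x y, adj x y -> c x <> c y) ->
  colorable adj k.
Proof.
move=> ck cP; exists (fun x => Ordinal (ck x)) => x y /cP ncxy.
by move/(congr1 val).
Qed.

(** * Closed walks and bipartiteness *)

Section Walks.
Variables (G : groupType) (S : set G).
Hypothesis abelianG : forall x y : G, x * y = y * x.

Definition word (w : seq G) := all (fun s => `[< S s >]) w.

(** Left translations are automorphisms of the Cayley graph, so a walk is recorded by its steps,
    with no starting vertex. *)
Definition odd_closed_word (w : seq G) :=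
  [/\ word w, odd (size w) & \prod_(s <- w) s = 1].

Lemma Cay_step (x s : G) : S s -> Cay S x (x * s).
Proof. by rewrite /Cay mulKg. Qed.

Lemma odd_closed_word_not_colorable2 (w : seq G) :
  odd_closed_word w -> ~ colorable (Cay S) 2.
Proof.
case=> Sw odd_w w1 [c cP].
suff /(_ 1 w Sw): forall x v, word v ->
    odd (c (x * \prod_(s <- v) s)) = odd (c x) (+) odd (size v).
  by rewrite odd_w w1 mulg1; case: odd.
move=> x v; elim: v x => [|s v IHv] x /=; first by rewrite big_nil mulg1 addbF.
case/andP=> /asboolP Ss /IHv {}IHv; rewrite big_cons mulgA IHv.
have := cP _ _ (Cay_step x Ss); case: (c x) (c (x * s)) => [[|[|//]] i] [[|[|//]] j] //=;
  try by case; apply: val_inj.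
all: by case: odd.
Qed.

Lemma word_cat (v w : seq G) : word (v ++ w) = word v && word w.
Proof. exact: all_cat. Qed.

Lemma word_inv (w : seq G) : symmetric_subset S ->
  word w -> word [seq s^-1 | s <- w].
Proof.
move=> symS; rewrite /word all_map => /allP Sw; apply/allP => s /Sw /asboolP Ss.
by apply/asboolP/(iffLR (symS s)).
Qed.

Lemma prod_inv (w : seq G) :
  \prod_(s <- [seq s^-1 | s <- w]) s = (\prod_(s <- w) s)^-1.
Proof.
elim: w => [|s w IHw]; first by rewrite !big_nil invg1.
by rewrite /= !big_cons IHw invgM abelianG.
Qed.

Lemma colorable2_no_odd_closed_word : symmetric_subset S ->
  (forall w, ~ odd_closed_word w) -> colorable (Cay S) 2.
Proof.
move=> symS noodd.
pose reach x y w := word w /\ y = x * \prod_(s <- w) s.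
have reachV x y w : reach x y w -> reach y x [seq s^-1 | s <- w].
  by case=> Sw ->; split; [apply: word_inv | rewrite prod_inv mulgK].
have reachD x y z v w : reach x y v -> reach y z w -> reach x z (v ++ w).
  by case=> Sv -> [Sw ->]; split; rewrite ?word_cat ?Sv // big_cat mulgA.
have [|||r [rP r_eq]] := @class_representatives G 1 (fun x y => exists w, reach x y w).
- by move=> x; exists [::]; split; rewrite ?big_nil ?mulg1.
- by move=> x y [w /reachV]; exists [seq s^-1 | s <- w].
- by move=> x y z [v Hv] [w Hw]; exists (v ++ w); apply: reachD Hv Hw.
have [p pP] := choice rP.
(* Colour [x] by the parity of a chosen walk [p x] to the representative of its component. If
   adjacent [x] and [y] had equal colours, the closed walk from [x] via [y] and [r x] back to [x]
   would be odd. *)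
apply: (@colorable_nat _ _ _ (fun x => odd (size (p x)))) => [x|x y Sxy]; first by case: odd.
have xy : reach x y [:: x^-1 * y].
  split; first by rewrite /word /= andbT; apply/asboolP.
  by rewrite big_seq1 mulVKg.
have rxy : r x = r y by apply: r_eq; exists [:: x^-1 * y].
move=> eq_odd; have py := pP y; rewrite -rxy in py.
have [Sw xw] := reachD _ _ _ _ _ (reachD _ _ _ _ _ xy py) (reachV _ _ _ (pP x)).
apply: (noodd _); split; first exact: Sw; last first.
  by apply: (mulgI x); rewrite -xw mulg1.
by rewrite !size_cat size_map !oddD; move: eq_odd; do 2!case: odd.
Qed.

End Walks.

(** * Ascents of a 3-colouring *)

Definition ascent (a b : 'I_3) : bool := b == a.+1 %% 3 :> nat.

(** With u ascents in two steps, the colour changes by 2u - 2 modulo 3; this determines u among 0,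
    1, 2. *)
Lemma ascent_square (a b b' d : 'I_3) :
  a <> b -> b <> d -> a <> b' -> b' <> d ->
  ascent a b + ascent b d = ascent a b' + ascent b' d.
Proof.
move=> /eqP + /eqP + /eqP + /eqP; rewrite /ascent -!val_eqE /=.
by case: a b b' d => [[|[|[|//]]] ?] [[|[|[|//]]] ?] [[|[|[|//]]] ?] [[|[|[|//]]] ?].
Qed.

(** With u ascents in four steps, returning to the first colour means that 3 divides 2u - 4, so u =
    2. *)
Lemma ascent_cycle4 (a b d e : 'I_3) :
  a <> b -> b <> d -> d <> e -> e <> a ->
  ascent a b + (ascent b d + (ascent d e + ascent e a)) = 2.
Proof.
move=> /eqP + /eqP + /eqP + /eqP; rewrite /ascent -!val_eqE /=.
by case: a b d e => [[|[|[|//]]] ?] [[|[|[|//]]] ?] [[|[|[|//]]] ?] [[|[|[|//]]] ?].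
Qed.

Section Ascents.
Variables (G : groupType) (S : set G) (c : G -> 'I_3).
Hypothesis abelianG : forall x y : G, x * y = y * x.
Hypothesis cP : proper_coloring (Cay S) c.

Fixpoint ascents (x : G) (w : seq G) : nat :=
  if w is s :: v then ascent (c x) (c (x * s)) + ascents (x * s) v else 0.

Lemma ascents_cat (x : G) (v w : seq G) :
  ascents x (v ++ w) = ascents x v + ascents (x * \prod_(s <- v) s) w.
Proof.
elim: v x => [|s v IHv] x /=; first by rewrite big_nil mulg1.
by rewrite IHv big_cons mulgA addnA.
Qed.

(** Move [s] past one step [t] at a time; each swap exchanges the two sides of the square on [x],
    [x * s], [x * t], [x * s * t]. *)
Lemma ascents_rcons (x s : G) (w : seq G) : S s -> word S w ->
  ascents x (s :: w) = ascents x (rcons w s).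
Proof.
move=> Ss; elim: w x => [//|t w IHw] x /= /andP[/asboolP St /IHw {}IHw].
rewrite -IHw /= !addnA -(mulgA x t s) -(abelianG s t) (mulgA x s t).
congr (_ + _); apply: ascent_square; try exact: cP (Cay_step _ _).
by rewrite -mulgA (abelianG s t) mulgA; exact: cP (Cay_step _ _).
Qed.

Lemma ascents_catC (x : G) (v w : seq G) : word S v -> word S w ->
  ascents x (v ++ w) = ascents x (w ++ v).
Proof.
elim: v w => [|s v IHv] w /=; first by rewrite cats0.
case/andP=> /asboolP Ss Sv Sw.
rewrite -/(ascents x (s :: (v ++ w))) ascents_rcons //; last by rewrite word_cat Sv.
rewrite rcons_cat IHv //; first by rewrite cat_rcons.
by rewrite /word all_rcons; apply/andP; split=> //; apply/asboolP.
Qed.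

Lemma ascents_perm (x : G) (v w : seq G) : perm_eq v w -> word S v ->
  ascents x v = ascents x w.
Proof.
move=> vw Sv; have Sw : word S w by rewrite /word -(perm_all _ vw).
move: vw Sw.
pose P u := word S u -> ascents x v = ascents x u.
move/(@catCA_perm_ind _ P); apply=> // u1 u2 u3 IH; rewrite /P !word_cat => /and3P[S2 S1 S3]; rewrite IH ?word_cat ?S1 ?S2 //.
rewrite !catA (ascents_cat _ (u1 ++ u2)) (ascents_cat _ (u2 ++ u1)) !big_cat /=.
by rewrite (abelianG (\prod_(s <- u1) s)) (ascents_catC _ S1 S2).
Qed.

Lemma ascents_four_times (x : G) (w : seq G) : (forall g : G, g ^+ 4 = 1) ->
  word S w -> ascents x (w ++ w ++ w ++ w) = (size w).*2.
Proof.
move=> G4; elim: w => [//|s w IHw] Ssw.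
have /andP[/asboolP Ss Sw] := Ssw.
(* Gather the four copies of [s] in front: they form a closed walk with 2 ascents, and the rest
   starts at [x] again. *)
rewrite (@ascents_perm _ _ ([:: s; s; s; s] ++ w ++ w ++ w ++ w)); last first.
- by rewrite !word_cat Ssw.
- by apply/permP => a; rewrite !count_cat /=; lia.
have s4 : s * (s * (s * s)) = 1 by rewrite -(G4 s) !expgS expg0 mulg1.
have xs4 : x * s * s * s * s = x by rewrite -!mulgA s4 mulg1.
rewrite ascents_cat !big_cons big_nil mulg1 s4 mulg1 IHw //= xs4 addn0.
rewrite ascent_cycle4 ?doubleS //; try exact: cP (Cay_step _ _).
by have := cP (Cay_step (x * s * s * s) Ss); rewrite xs4.
Qed.

Lemma no_odd_closed_word_exp4 (w : seq G) : (forall g : G, g ^+ 4 = 1) ->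
  ~ odd_closed_word S w.
Proof.
move=> G4 [Sw odd_w w1]; have := ascents_four_times 1 G4 Sw.
by rewrite !ascents_cat w1 !mulg1; lia.
Qed.

End Ascents.

(** * Circulant graphs on the cosets of a cyclic subgroup *)

Section Circulant.
Variable G : groupType.
Hypothesis abelianG : forall x y : G, x * y = y * x.

(* With [n = 0] when [g] has infinite order. *)
Lemma order_exists (g : G) : exists n, forall a, g ^+ a = 1 <-> n %| a.
Proof.
have [exn|nex] := pselect (exists n, (0 < n) && (g ^+ n == 1)); last first.
  exists 0 => a; rewrite dvd0n; split=> [ga|/eqP-> //].
  by case: a ga => // a ga; case: nex; exists a.+1; apply/eqP.
case: (ex_minnP exn) => n /andP[n_gt0 /eqP gn] n_min; exists n => a.
split=> [ga|/dvdnP[q ->]]; last by rewrite mulnC expgnA gn expg1n.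
apply/eqP; have := n_min (a %% n).
move: ga; rewrite {1}(divn_eq a n) expgnDr mulnC expgnA gn expg1n mul1g => ->.
have := ltn_pmod a n_gt0; rewrite eqxx andbT; lia.
Qed.

Lemma expg_eq_mod (h : G) (n : nat) : (forall a, h ^+ a = 1 <-> n %| a) ->
  forall a b, h ^+ a = h ^+ b -> a = b %[mod n].
Proof.
move=> hn a b; wlog le_ba : a b / b <= a => [IH|].
  by case/orP: (leq_total a b) => le E; [apply/esym/IH | apply: IH].
move=> E; apply/eqP; rewrite eqn_mod_dvd //; apply/hn.
by rewrite expgnFr // E mulgV.
Qed.

Definition circulant_set (h : G) (K : seq nat) : set G :=
  fun s => exists2 k, k \in K & s = h ^+ k \/ s = h ^- k.

Lemma circulant_set_sym (h : G) (K : seq nat) :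
  symmetric_subset (circulant_set h K).
Proof.
have sub s : circulant_set h K s -> circulant_set h K s^-1.
  by case=> k Kk [] ->; exists k => //; rewrite ?invgK; [right | left].
by move=> s; split=> /sub //; rewrite invgK.
Qed.

(* Modulo [N], the function [f] is the discrete logarithm to base [h] on each
   coset of the subgroup generated by [h], relative to a representative. *)
Lemma coset_log (h : G) (N : nat) : 0 < N ->
  (forall a b, h ^+ a = h ^+ b -> a = b %[mod N]) ->
  exists f : G -> nat, forall x i, f (x * h ^+ i) = f x + i %[mod N].
Proof.
move=> N_gt0 hN.
have [|||r [rP r_eq]] :=
    @class_representatives G 1 (fun x y => exists a b, x * h ^+ a = y * h ^+ b).
- by move=> x; exists 0, 0.
- by move=> x y [a [b E]]; exists b, a.
- move=> x y z [a [b E]] [a' [b' E']]; exists (a + a'), (b' + b).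
  by rewrite !expgnDr !mulgA E -E' -!mulgA (abelianG (h ^+ b)).
have [A AP] := choice rP; have [B ABP] := choice AP.
(* As [x * h ^+ A x = r x * h ^+ B x], the logarithm is [B x - A x]; the factor [N.-1] stands for -1
   modulo [N]. *)
exists (fun x => B x + N.-1 * A x)%N => x i.
set y := x * h ^+ i.
have ry : r y = r x by apply/esym/r_eq; exists i, 0; rewrite /y expg0 mulg1.
have Ex := ABP x; have Ey := ABP y; rewrite ry in Ey.
have /hN : h ^+ (B y + A x) = h ^+ (B x + i + A y).
  apply: (mulgI (r x)); rewrite !expgnDr !mulgA -Ey -Ex /y -!mulgA.
  by congr (x * _); rewrite -!expgnDr; congr (h ^+ _); lia.
move/eqP=> E; apply/eqP; rewrite -(eqn_modDr (A x + A y)).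
have -> : (B y + N.-1 * A y + (A x + A y) = A y * N + (B y + A x))%N by nia.
have -> : (B x + N.-1 * A x + i + (A x + A y) = A x * N + (B x + i + A y))%N by nia.
by rewrite !modnMDl.
Qed.

(** The logarithm of [coset_log] maps the graph homomorphically to a circulant graph modulo [N],
    whose colouring [c] is pulled back. [N] may be a proper divisor of the order. *)
Lemma circulant_colorable (h : G) (N k : nat) (K : seq nat) (c : nat -> nat) :
  0 < N -> (forall a b, h ^+ a = h ^+ b -> a = b %[mod N]) ->
  (forall i, i < N -> c i < k) ->
  (forall i j, i < N -> j \in K -> c i <> c ((i + j) %% N)) ->
  colorable (Cay (circulant_set h K)) k.
Proof.
move=> N_gt0 hN ck cP; have [f fP] := coset_log N_gt0 hN.
apply: (@colorable_nat _ _ _ (fun x => c (f x %% N))) => [x|x y].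
  by apply: ck; rewrite ltn_pmod.
have step z j : j \in K -> c (f z %% N) <> c (f (z * h ^+ j) %% N).
  by rewrite fP -modnDml; apply: cP; rewrite ltn_pmod.
case=> j Kj [] E; first by rewrite -(mulVKg x y) E; apply: step.
have -> : x = y * h ^+ j by rewrite -(mulVKg x y) E mulgVK.
by move=> /esym; apply: step.
Qed.

Lemma circulant_chromatic3 (h : G) (K : seq nat) (w : seq G) :
  odd_closed_word (circulant_set h K) w ->
  colorable (Cay (circulant_set h K)) 3 ->
  exists S : set G, symmetric_subset S /\ has_chromatic_number (Cay S) 3.
Proof.
move=> oddw col3; exists (circulant_set h K); split; first exact: circulant_set_sym.
split=> // m colm; rewrite ltnNge; apply/negP => m2.
exact: odd_closed_word_not_colorable2 oddw (colorable_leq m2 colm).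
Qed.

Lemma circulant_setX (h : G) (K : seq nat) (k : nat) :
  k \in K -> circulant_set h K (h ^+ k).
Proof. by exists k => //; left. Qed.

Lemma chromatic3_infinite_order (h : G) : (forall a, h ^+ a = 1 <-> 0 %| a) ->
  exists S : set G, symmetric_subset S /\ has_chromatic_number (Cay S) 3.
Proof.
move=> h0; apply: (@circulant_chromatic3 h [:: 1; 2]%N [:: h ^+ 1; h ^+ 1; h ^- 2]).
  split=> //; last by rewrite !big_cons big_nil mulg1 mulgA -expgnDr mulgV.
  rewrite /word /= !asboolT //; try exact: circulant_setX.
  by exists 2 => //; right.
(* Colour by the exponent modulo 3. Congruence modulo 0 is equality, so it implies congruence modulo
   3. *)
apply: (@circulant_colorable h 3 3 _ id) => // [a b /(expg_eq_mod h0)|i j].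
  by rewrite !modn0 => ->.
by case: i => [|[|[|//]]] _; rewrite !inE => /orP[] /eqP->.
Qed.

Lemma chromatic3_odd_order (h : G) (m : nat) : odd m -> 1 < m ->
  (forall a, h ^+ a = 1 <-> m %| a) ->
  exists S : set G, symmetric_subset S /\ has_chromatic_number (Cay S) 3.
Proof.
move=> odd_m m_gt1 hm; apply: (@circulant_chromatic3 h [:: 1]%N (nseq m (h ^+ 1))).
  split; rewrite ?size_nseq //; last by rewrite big_nseq iter_mulg mulg1; apply/hm.
  by rewrite /word all_nseq asboolT ?orbT //; exact: circulant_setX.
(* On a cycle of length [m], alternate 0 and 1, and give the last vertex colour 2. *)
apply: (@circulant_colorable h m 3 _ (fun i => if i == m.-1 then 2 else odd i : nat)).
- lia.
- exact: expg_eq_mod.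
- by move=> i _; case: ifP => // _; case: odd.
move=> i j i_lt; rewrite inE => /eqP->.
have [->|i_neq] := eqVneq i m.-1.
  by rewrite addn1 prednK ?modnn; [case: eqP => //; lia | lia].
rewrite modn_small; last lia.
by case: eqP => _; rewrite ?addn1 /=; case: (odd i).
Qed.

(* The graph is the Moebius ladder on 8 vertices. *)
Lemma chromatic3_order8 (h : G) : (forall a, h ^+ a = 1 <-> 8 %| a) ->
  exists S : set G, symmetric_subset S /\ has_chromatic_number (Cay S) 3.
Proof.
move=> h8; apply: (@circulant_chromatic3 h [:: 1; 4]%N (h ^+ 4 :: nseq 4 (h ^+ 1))).
  split=> //; first by rewrite /word /= !asboolT //; exact: circulant_setX.
  by rewrite big_cons big_nseq iter_mulg mulg1 -expgnDr; apply/h8.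
(* Cyclic neighbours differ in this list, and so do the entries at distance 4. *)
apply: (@circulant_colorable h 8 3 _ (nth 0 [:: 0; 1; 0; 1; 2; 0; 1; 2]%N)) => //.
- exact: expg_eq_mod.
- by do 8?case=> //.
by move=> i j i_lt; rewrite !inE => /orP[] /eqP->; move: i i_lt; do 8?case=> //.
Qed.

Lemma order_expg (g : G) (d n : nat) : 0 < d ->
  (forall a, g ^+ a = 1 <-> (d * n)%N %| a) ->
  forall a, (g ^+ d) ^+ a = 1 <-> n %| a.
Proof. by move=> d_gt0 gn a; rewrite -expgnA gn dvdn_pmul2l. Qed.

Lemma chromatic3_of_expg4 (g : G) : g ^+ 4 <> 1 ->
  exists S : set G, symmetric_subset S /\ has_chromatic_number (Cay S) 3.
Proof.
move=> g4; have [n gn] := order_exists g.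
have [n0|n_gt0] := posnP n; first by rewrite n0 in gn; exact: chromatic3_infinite_order gn.
(* Write the order as [m * 2 ^ k] with [m] odd. Either [g ^+ (2 ^ k)] has odd order [m > 1], or
   [m = 1] and [g ^+ 4 <> 1] forces [k >= 3], so that [g ^+ (2 ^ (k - 3))] has order 8. *)
have [m odd_m n_eq] := pfactor_coprime (isT : prime 2) n_gt0.
rewrite coprime2n in odd_m; set k := logn 2 n in n_eq.
have [m_gt1|m_le1] := ltnP 1 m.
  apply: (chromatic3_odd_order odd_m m_gt1) (@order_expg g (2 ^ k)%N m _ _).
    by rewrite expn_gt0.
  by rewrite mulnC -n_eq.
have m1 : m = 1%N by lia.
rewrite m1 mul1n in n_eq.
have k_ge3 : 2 < k.
  rewrite ltnNge; apply/negP => k_le2; apply: g4; apply/gn.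
  by rewrite n_eq (dvdn_exp2l 2 k_le2).
apply: (chromatic3_order8 (@order_expg g (2 ^ (k - 3))%N 8 _ _)).
  by rewrite expn_gt0.
by rewrite -(expnD 2 _ 3) subnK // -n_eq.
Qed.

End Circulant.

(** * The exponent condition and the equivalence *)

Lemma group_exponent_124 (G : groupType) :
  (group_exponent G \in [:: 1; 2; 4]%N) <-> (forall g : G, g ^+ 4 = 1).
Proof.
split=> [e124 g|G4].
  have [[k /group_exponentP[[e_gt0 eP] _]]|nex] := pselect (exists k, annihilates G k).
    have /dvdnP[q ->] : group_exponent G %| 4.
      by move: e124; rewrite !inE => /or3P[] /eqP->.
    by rewrite mulnC expgnA eP expg1n.
  by move/group_exponent0: nex e124 => ->.
have [[e_gt0 eP] e_le4] := group_exponentP (conj (isT : 0 < 4) G4).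
(* Third and fourth powers both trivial would make [G] trivial, with exponent 1. *)
have e_neq3 : group_exponent G <> 3.
  move=> e3; rewrite e3 in eP.
  have G1 (g : G) : g ^+ 1 = 1 by have := G4 g; rewrite expgSr eP mul1g.
  by have [_] := group_exponentP (conj (isT : 0 < 1) G1); rewrite e3.
by rewrite !inE; lia.
Qed.

Local Close Scope group_scope.

Theorem theorem1p2 (G : groupType)
    (abelianG : forall x y : G, (x * y)%g = (y * x)%g) :
  (exists S : set G, symmetric_subset S /\ has_chromatic_number (Cay S) 3)
  <-> group_exponent G \notin [:: 1; 2; 4].
Proof.
split=> [[S [symS [[c cP] min3]]]|].
  apply/negP => /group_exponent_124 G4.
  suff /min3: colorable (Cay S) 2 by [].
  apply: colorable2_no_odd_closed_word => // w.
  exact: no_odd_closed_word_exp4 abelianG cP w G4.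
move/negP; rewrite group_exponent_124 => /existsNP[g].
exact: chromatic3_of_expg4.
Qed.
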